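(* Let $N\ge 2$ and $1\le a,b\le N-1$ be integers with $\gcd(N,a,b)=1$, and let $k$ be the diameter of the three-quarters digraph $TQ(N,a,b)$. Then $$N\le \sum_{r=0}^{k}(1+3r)=\frac{1}{2}\left(3k^2+5k+2\right).$$
   Context: For integers $N\ge 2$ and $1\le a,b\le N-1$ with $\gcd(N,a,b)=1$, the three-quarters digraph $TQ(N,a,b)$ has vertex set $\mathbb{Z}_N$ (integers modulo $N$), and each vertex $i$ is joined by arcs to $i+a$ and $i+b$ (mod $N$); it is the circulant digraph with steps $a,b$, equipped with the following distance-like function. For $x,y\in\mathbb{Z}_N$, $d(x,y)$ is the minimum integer $\ell\ge 0$ such that there exist integers $m,n'\ge 0$ with $m+n'=\ell$ and $$y-x\equiv ma+n'b,\quad\text{or}\quad y-x\equiv -ma+n'b,\quad\text{or}\quad y-x\equiv ma-n'b \pmod N.$$ (The combination $-ma-n'b$ with both $m,n'>0$ is not allowed.) The function $d$ is translation invariant, $d(x,y)=d(0,y-x)$, but need not be symmetric. The diameter of $TQ(N,a,b)$ is $\max_{x,y\in\mathbb{Z}_N} d(x,y)=\max_{z\in\mathbb{Z}_N} d(0,z)$. *)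

(* Defs.v *)
From mathcomp Require Import all_boot all_order all_algebra.

Set Implicit Arguments.
Unset Strict Implicit.
Unset Printing Implicit Defensive.

Import GRing.Theory.
Local Open Scope ring_scope.

(* [tq_conn N a b l x y]: y - x is one of the three allowed combinations of
   a and b with coefficients m, n >= 0 such that m + n = l.  The condition
   m + n = l forces m, n <= l, so that m and n can range over 'I_l.+1.
   'Z_N is the ring of integers modulo N only for N > 1. *)
Definition tq_conn (N a b l : nat) (x y : 'Z_N) : bool :=
  [exists m : 'I_l.+1, exists n : 'I_l.+1, (m + n == l)%N &&
    [|| y - x == (m * a)%:R + (n * b)%:R,
        y - x == - (m * a)%:R + (n * b)%:R
      | y - x == (m * a)%:R - (n * b)%:R]].

Lemma tq_conn_exists (N a b : nat) (hN : (1 < N)%N)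
    (hgcd : gcdn N (gcdn a b) = 1%N) (x y : 'Z_N) :
  exists l, tq_conn a b l x y.
Proof.
have N0 : N%:R = 0 :> 'Z_N by rewrite pchar_Zp.
have dvd0 k : (N %| k)%N -> k%:R = 0 :> 'Z_N.
  by case/dvdnP=> q ->; rewrite natrM N0 mulr0.
have [u _ hu] := Bezoutl a (ltnW hN).
have g0 : (0 < gcdn N a)%N by rewrite gcdn_gt0 (ltnW hN).
have [v _] := Bezoutl b g0.
rewrite -gcdnA hgcd => /dvdnP[w hw].
have hg : (gcdn N a)%:R = - (u%:R * a%:R) :> 'Z_N.
  by apply/eqP; rewrite -addr_eq0 -natrM -natrD dvd0.
have h1 : 1 = - (w%:R * u%:R * a%:R) - v%:R * b%:R :> 'Z_N.
  have /(congr1 (fun k => k%:R : 'Z_N)) := hw.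
  rewrite /= natrD !natrM hg mulrN mulrA => <-.
  by rewrite addrK.
have [m [n hmn]] : exists m n : 'Z_N, y - x = m * a%:R + n * b%:R.
  exists (- ((y - x) * (w%:R * u%:R))), (- ((y - x) * v%:R)).
  by rewrite -{1}[y - x]mulr1 {1}h1 mulrBr mulrN !mulNr !mulrA.
exists (m + n)%N.
apply/existsP; exists (Ordinal (leq_addr n m : m < (m + n).+1)%N).
apply/existsP; exists (Ordinal (leq_addl m n : n < (m + n).+1)%N).
by rewrite /= eqxx /= !natrM !natr_Zp hmn eqxx.
Qed.

Definition tq_dist (N a b : nat) (hN : (1 < N)%N)
    (hgcd : gcdn N (gcdn a b) = 1%N) (x y : 'Z_N) : nat :=
  ex_minn (tq_conn_exists hN hgcd x y).

Definition tq_diam (N a b : nat) (hN : (1 < N)%N)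
    (hgcd : gcdn N (gcdn a b) = 1%N) : nat :=
  (\max_(x : 'Z_N) \max_(y : 'Z_N) tq_dist hN hgcd x y)%N.

(* Main.v *)
Require Import Defs.
From mathcomp Require Import all_boot all_order all_algebra.
From mathcomp Require Import zify ring.

Set Implicit Arguments.
Unset Strict Implicit.
Unset Printing Implicit Defensive.

Import GRing.Theory.
Local Open Scope ring_scope.

(** A residue at distance [l] from 0 is a signed combination with [m + n = l]. Each of the three
    quadrants has [l + 1] such pairs and two half-axes are shared, so there are at most [3 * l + 1]
    values ([tq_conn_sphere]). The spheres of radius 0 to the diameter cover ['Z_N], and adding
    their sizes bounds [N] ([leq_tq_diam]). *)

(* The half-axes belong to two quadrants each. To get exactly [3 * l + 1]
   entries, the second block keeps only [m > 0] and the third only [n > 0]. *)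
Definition tq_sphere (N a b l : nat) : seq 'Z_N :=
  [seq (m * a)%:R + ((l - m) * b)%:R | m <- iota 0 l.+1] ++
  [seq - (m * a)%:R + ((l - m) * b)%:R | m <- iota 1 l] ++
  [seq (m * a)%:R - ((l - m) * b)%:R | m <- iota 0 l].

Lemma size_tq_sphere (N a b l : nat) : size (tq_sphere N a b l) = (1 + 3 * l)%N.
Proof. by rewrite !size_cat !size_map !size_iota; lia. Qed.

Lemma tq_conn_sphere (N a b l : nat) (x y : 'Z_N) :
  tq_conn a b l x y -> y - x \in tq_sphere N a b l.
Proof.
case/existsP=> m /existsP[n /andP[/eqP hl]].
have -> : nat_of_ord n = (l - m)%N by lia.
have hm := ltn_ord m; rewrite /tq_sphere !mem_cat.
have first_block (z : 'Z_N) : z = (m * a)%:R + ((l - m) * b)%:R ->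
    z \in [seq (i * a)%:R + ((l - i) * b)%:R | i <- iota 0 l.+1].
  by move=> ->; apply/mapP; exists (m : nat); rewrite // mem_iota; lia.
case/or3P=> /eqP hyx; first by rewrite first_block.
(* On the half-axis [m = 0] the sign before [a] is void, so the value is already in the first
   block. *)
- have [m0|m_gt0] := posnP m.
    by rewrite first_block // hyx m0 mul0n oppr0.
  apply/orP; right; apply/orP; left; apply/mapP; exists (m : nat) => //.
  by rewrite mem_iota; lia.
(* Here [l <= m] means [n = 0], the other shared half-axis. *)
- have [m_ge|m_lt] := leqP l m.
    by rewrite first_block // hyx (eqP (_ : l - m == 0)%N) ?subn_eq0 // mul0n oppr0.
  apply/orP; right; apply/orP; right; apply/mapP; exists (m : nat) => //.
  by rewrite mem_iota; lia.
Qed.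

Lemma tq_dist_conn (N a b : nat) (hN : (1 < N)%N)
    (hgcd : gcdn N (gcdn a b) = 1%N) (x y : 'Z_N) :
  tq_conn a b (tq_dist hN hgcd x y) x y.
Proof. by rewrite /tq_dist; case: ex_minnP. Qed.

Lemma tq_dist_le_diam (N a b : nat) (hN : (1 < N)%N)
    (hgcd : gcdn N (gcdn a b) = 1%N) (x y : 'Z_N) :
  (tq_dist hN hgcd x y <= tq_diam hN hgcd)%N.
Proof.
apply: leq_trans (leq_bigmax y) _.
exact: (leq_bigmax (F := fun x : 'Z_N => \max_(y : 'Z_N) tq_dist hN hgcd x y)%N).
Qed.

Lemma leq_tq_diam (N a b : nat) (hN : (1 < N)%N)
    (hgcd : gcdn N (gcdn a b) = 1%N) :
  (N <= \sum_(0 <= r < (tq_diam hN hgcd).+1) (1 + 3 * r))%N.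
Proof.
set k := tq_diam hN hgcd.
(* Repetitions in [s] are harmless: its size only has to bound the number of distinct residues. *)
pose s := flatten [seq tq_sphere N a b l | l <- iota 0 k.+1].
have -> : (\sum_(0 <= r < k.+1) (1 + 3 * r))%N = size s.
  rewrite size_flatten /shape -map_comp sumnE big_map /index_iota subn0.
  by apply: eq_bigr => l _; rewrite -(size_tq_sphere N a b).
rewrite -[leqLHS](Zp_cast hN) -[leqLHS]card_ord; apply: leq_trans (card_size s).
apply/subset_leq_card/subsetP => z _; apply/flatten_mapP.
(* Each [z] lies in the sphere whose radius is its own distance from 0. *)
exists (tq_dist hN hgcd 0 z); last first.
  by rewrite -[z]subr0 tq_conn_sphere // subr0 tq_dist_conn.
by rewrite mem_iota /= add0n ltnS tq_dist_le_diam.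
Qed.

Lemma sum_tq_sphere_sizes (k : nat) :
  (\sum_(0 <= r < k.+1) (1 + 3 * r))%N%:R =
    1 / 2 * (3 * k%:R ^+ 2 + 5 * k%:R + 2) :> rat.
Proof.
elim: k => [|k IHk]; first by rewrite big_nat1.
by rewrite big_nat_recr //= natrD IHk natrD natrM -natr1; field.
Qed.

Theorem mainTheorem3 (N a b : nat) (hN : (2 <= N)%N)
    (ha : (1 <= a <= N - 1)%N) (hb : (1 <= b <= N - 1)%N)
    (hgcd : gcdn N (gcdn a b) = 1%N)
    (k : nat) (hk : k = tq_diam hN hgcd) :
  (N <= \sum_(0 <= r < k.+1) (1 + 3 * r))%N /\
  (\sum_(0 <= r < k.+1) (1 + 3 * r))%N%:R =
    1 / 2 * (3 * k%:R ^+ 2 + 5 * k%:R + 2) :> rat.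
Proof.
by split; [rewrite hk; exact: leq_tq_diam | exact: sum_tq_sphere_sizes].
Qed.
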